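(* There is an absolute constant $C>0$ such that the following holds. Let $\varepsilon>0$, let $\pi$ be a target distribution on $\mathbb{R}^d$ satisfying the Cheeger isoperimetric inequality with some constant $\mathsf{Ch}>0$, and let $\mu$ be a proposal distribution on $\mathbb{R}^d$ such that $\mathsf R_q(\mu\|\pi)\le C_{\mathsf R}q^\gamma$ and $\mathsf R_q(\pi\|\mu)\le C_{\mathsf R}q^\gamma$ for all $1\le q\le C\log(1/\varepsilon)$, where $\gamma>0$ is an absolute constant and $C_{\mathsf R}>0$ satisfies $C_{\mathsf R}\ll(\log(1/\varepsilon))^{-(\gamma+1)}$ (i.e. $C_{\mathsf R}$ is at most a sufficiently small absolute constant times $(\log(1/\varepsilon))^{-(\gamma+1)}$). Assume further that both $\mu$ and $\pi$ are atomless. Then the independent Metropolis–Hastings algorithm (described in the context) returns a sample whose marginal distribution is within total variation distance $\varepsilon$ of $\pi$ after $N=\mathcal O(\log(1/\varepsilon))$ iterations.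
   Context: Rényi divergence of order $q>1$: $\mathsf R_q(\mu\|\nu)=\frac1{q-1}\log\int(\frac{d\mu}{d\nu})^q\,d\nu$, with $\mathsf R_1=\mathsf{KL}$. $\pi$ satisfies the Cheeger isoperimetric inequality with constant $\mathsf{Ch}$ if $\liminf_{\delta\to0^+}\frac{\pi(A^\delta)-\pi(A)}{\delta}\ge\frac1{\mathsf{Ch}}\pi(A)(1-\pi(A))$ for every measurable $A\subseteq\mathbb{R}^d$, where $A^\delta=\{x:\mathrm{dist}(x,A)<\delta\}$. Independent Metropolis–Hastings algorithm with target $\pi$ and proposal $\mu$: draw $x_0\sim\mu$; for $n=0,\dots,N-1$ draw $U\sim\mathrm{Unif}(0,1)$ and $z\sim\mu$ independently, set $a(x_n,z)=\frac12\min\bigl(1,\frac{\pi(z)\mu(x_n)}{\pi(x_n)\mu(z)}\bigr)$, and set $x_{n+1}=z$ if $U\le a(x_n,z)$, otherwise $x_{n+1}=x_n$; return $x_N$.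
   Formalization: The formal theorem takes ε below a constant ε₀ > 0 (depending at most on γ) rather than every ε > 0: for ε near 1 no q satisfies 1 ≤ q ≤ C log(1/ε), the Rényi bounds are void, and mutually singular μ and π give total variation distance 1. *)

(* Defs.v *)
From HB Require Import structures.
From mathcomp Require Import all_boot all_order all_algebra.
From mathcomp Require Import all_classical all_reals all_analysis.
Set Implicit Arguments. Unset Strict Implicit. Unset Printing Implicit Defensive.
Import Order.TTheory GRing.Theory Num.Theory.
Import numFieldNormedType.Exports.
Local Open Scope classical_set_scope.
Local Open Scope ring_scope.

Definition Rd (R : realType) (d : nat) :=
  g_sigma_algebraType (@open ('rV[R]_d)).

Definition eucl_norm (R : realType) (d : nat) (x : 'rV[R]_d) : R :=
  Num.sqrt (\sum_(i < d) (x ord0 i) ^+ 2).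

Definition enlargement (R : realType) (d : nat) (A : set 'rV[R]_d) (delta : R)
  : set 'rV[R]_d :=
  [set x | exists2 y, A y & eucl_norm (x - y) < delta].

(* Cheeger isoperimetric inequality with constant Ch:
   liminf_{delta -> 0+} (pi(A^delta) - pi(A))/delta >= pi(A)(1 - pi(A))/Ch
   for all measurable A; the liminf inequality is written out as
   "for every e > 0, eventually (as delta -> 0+) the quotient is >= RHS - e". *)
Definition cheeger (R : realType) (d : nat) (pi : probability (Rd R d) R)
  (Ch : R) : Prop :=
  forall A : set (Rd R d), measurable A ->
  forall e : R, 0 < e ->
    \forall delta \near 0^'+,
      fine (pi A) * (1 - fine (pi A)) / Ch - e
        <= (fine (pi (enlargement A delta)) - fine (pi A)) / delta.

Definition atomless d (T : measurableType d) (R : realType)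
  (m : {measure set T -> \bar R}) : Prop :=
  forall A : set T, measurable A -> (0 < m A)%E ->
    exists B : set T, [/\ measurable B, B `<=` A, (0 < m B)%E & (m B < m A)%E].

(* Renyi divergence of order q >= 1 of the measure with density p w.r.t.
   lam from the measure with density f w.r.t. lam:
   R_q = 1/(q-1) log \int (p/f)^q f dlam  (q > 1),  R_1 = KL = \int p log(p/f),
   with the usual conventions (value +oo when absolute continuity fails). *)
Definition renyi d (T : measurableType d) (R : realType)
  (lam : {measure set T -> \bar R}) (p f : T -> R) (q : R) : \bar R :=
  if q == 1 then
    (\int[lam]_x (if p x == 0%R then 0%E
                  else if f x == 0%R then +oo%E
                  else (p x * ln (p x / f x))%:E))%E
  else
    let I := (\int[lam]_x (if f x == 0%R then (if p x == 0%R then 0%E else +oo%E)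
                           else ((p x / f x) `^ q * f x)%:E))%E in
    if I == +oo%E then +oo%E else ((q - 1)^-1 * ln (fine I))%:E.

Definition imh_accept (T : Type) (R : realType) (pid mud : T -> R) (x z : T) : R :=
  2^-1 * Num.min 1 (pid z * mud x / (pid x * mud z)).

(* One step of the independent Metropolis-Hastings chain acting on
   nonnegative test functions:  (P g)(x) = E[g(x_1) | x_0 = x], where
   z ~ mu and U ~ Unif(0,1) independently, and x_1 = z if U <= a(x,z),
   x_1 = x otherwise. *)
Definition imh_step d (T : measurableType d) (R : realType)
  (mu : {measure set T -> \bar R}) (a : T -> T -> R) (g : T -> \bar R)
  : T -> \bar R :=
  fun x => (\int[mu]_z \int[@lebesgue_measure R]_(u in `[0%R, 1%R])
               (if ((u : R) <= a x z)%R then g z else g x))%E.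

(* Law of x_N when x_0 ~ mu:  P(x_N in A) = \int (P^N 1_A) dmu. *)
Definition imh_law d (T : measurableType d) (R : realType)
  (mu : {measure set T -> \bar R}) (a : T -> T -> R) (N : nat) (A : set T)
  : \bar R :=
  (\int[mu]_x iter N (imh_step mu a) (fun y => (\1_A y)%:E) x)%E.

(* Main.v *)
(* Let w = dpi/dmu. Since w(x) a(x,z) = min(w(x), w(z)) / 2 is symmetric, the
   chain is reversible for pi. On {w <= M} it is moreover minorized by pi / (2M),
   so the L^1(pi) distance of P^N 1_A to pi(A) contracts geometrically up to
   a multiple of pi(w > M). Integrating against mu instead of pi costs a factor
   M and an error mu(w < 1/M). With M = e^2, Markov's inequality for the Renyi
   moments of order q = 3 log(1/eps) makes both tails at most e eps^3, because
   C_R q^gamma <= 1. *)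
Require Import Defs.
From HB Require Import structures.
From mathcomp Require Import all_boot all_order all_algebra.
From mathcomp Require Import all_classical all_reals all_analysis.
From mathcomp Require Import measurable_realfun.
From mathcomp Require Import ring lra.
Set Implicit Arguments. Unset Strict Implicit. Unset Printing Implicit Defensive.
Import Order.TTheory GRing.Theory Num.Theory.
Import numFieldNormedType.Exports.
Local Open Scope classical_set_scope.
Local Open Scope ring_scope.

(** The obstacle is that [w] may be unbounded, so the kernel need not satisfy a uniform Doeblin
    condition. Only the truncated density of [pi], equal to [w] where [w <= M] and to 0 elsewhere,
    minorizes, and its mass falls short of one by [pi(w > M)]. Measuring distances in L^1(pi) lets
    invariance of [pi] absorb visits to the bad region: the missing mass becomes the fixed point of
    an affine recursion, so it is paid once and not at every iteration. The rate is of order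
    [1 / M], so [M] has to be an absolute constant if order log(1/eps) steps are to suffice.
    Smallness of the tails must then come from the order [q]: a moment of at most e^(q-1) against a
    threshold M^(q-1) = e^(2(q-1)) leaves e^(-(q-1)). A power of eps above one leaves room for the
    factor [M] lost in the change of initial law. *)

Lemma integral_uniform_if (R : realType) (a p q : R) :
  0 <= a -> a <= 1 -> 0 <= p -> 0 <= q ->
  (\int[@lebesgue_measure R]_(u in `[0%R, 1%R])
     (if ((u : R) <= a)%R then p%:E else q%:E) = (a * p + (1 - a) * q)%:E)%E.
Proof.
move=> a0 a1 p0 q0.
have split01 : `[0%R, 1%R]%classic = `[0%R, a]%classic `|` `]a, 1%R]%classic.
  by rewrite -itv_bndbnd_setU// bnd_simp.
have dis : [disjoint `[0%R, a]%classic & `]a, 1%R]%classic].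
  apply/disj_setPS => y [/=]; rewrite !in_itv/= => /andP[_ ya] /andP[].
  by rewrite ltNge ya.
rewrite split01 ge0_integral_setU//; last 2 first.
- apply: measurable_fun_if => //.
  + exact: measurableU.
  + exact: measurable_fun_ler.
- by move=> x _; case: ifP; rewrite lee_fin.
rewrite (eq_integral (cst p%:E)); last first.
  by move=> x; rewrite inE/= in_itv/= => /andP[_ ->].
rewrite [X in (_ + X)%E](eq_integral (cst q%:E)); last first.
  by move=> x; rewrite inE/= in_itv/= => /andP[+ _]; rewrite ltNge => /negbTE ->.
have itvE (b1 b2 : bool) (s t : R) : s <= t ->
    @lebesgue_measure R [set` Interval (BSide b1 s) (BSide b2 t)] = (t - s)%:E.
  move=> st; rewrite lebesgue_measure_itv/= lte_fin -EFinB.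
  by case: ltgtP st => // -> _; rewrite subrr.
rewrite !integral_cst//= !itvE// -!EFinM -EFinD; congr EFin; ring.
Qed.

Lemma Rintegral_probability_cst d (T : measurableType d) (R : realType)
  (mu : probability T R) (r : R) : \int[mu]_x r = r.
Proof. by rewrite Rintegral_cst//= probability_setT mulr1. Qed.

Lemma measurable_set_ltr d (T : measurableType d) (R : realType) (f g : T -> R) :
  measurable_fun setT f -> measurable_fun setT g ->
  measurable [set x | f x < g x].
Proof.
move=> mf mg; rewrite -[X in measurable X]setTI.
exact: (measurable_fun_ltr mf mg measurableT (Y := [set true])).
Qed.

(** * Reversible resampling kernels and their invariant weight *)

Section reversible_resampling.
Context d (T : measurableType d) (R : realType) (mu : probability T R).
Context (a : T -> T -> R) (w : T -> R).
Hypothesis ma : measurable_fun [set: T * T] (fun p => a p.1 p.2).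
Hypothesis a01 : forall x z, 0 <= a x z <= 1.
Hypothesis mw : measurable_fun setT w.
Hypothesis w0 : forall x, 0 <= w x.
Hypothesis iw : (\int[mu]_x (w x)%:E = 1)%E.
Hypothesis detailed_balance : forall x z, w x * a x z = w z * a z x.

(** The accepted part of the kernel, a sub-Markov operator: [move (cst 1) x] is the probability of
    accepting from [x], and its complement in [resample] is the mass that stays put. *)
Let move g x : R := \int[mu]_z (a x z * g z).

Definition resample (g : T -> R) (x : T) : R :=
  move g x + (1 - move (cst 1) x) * g x.

Lemma bounded_integrableT (g : T -> R) (M : R) : measurable_fun setT g ->
  (forall x, `|g x| <= M) -> mu.-integrable setT (EFin \o g).
Proof.
move=> mg gM; apply: measurable_bounded_integrable => //.
  exact: (le_lt_trans (probability_le1 mu measurableT) (ltry 1)).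
exists M; split; first exact: num_real.
by move=> t Mt x _ /=; rewrite (le_trans (gM x))// ltW.
Qed.

(** A general [v] below [w] serves both for [w] itself and for its minorizing part [u]. *)
Lemma dominated_integrable (v g : T -> R) (M : R) : measurable_fun setT v ->
  (forall x, `|v x| <= w x) -> measurable_fun setT g ->
  (forall x, `|g x| <= M) -> mu.-integrable setT (EFin \o (fun x => v x * g x)).
Proof.
move=> mv vw mg gM.
have iMw : mu.-integrable setT (fun x => (M%:E * (w x)%:E)%E).
  apply: integrableZl => //; apply/integrableP; split; first exact/measurable_EFinP.
  by under eq_integral do rewrite gee0_abs ?lee_fin//; rewrite iw ltry.
apply: le_integrable iMw => //.
  by apply/measurable_EFinP; exact: measurable_funM.
move=> x _ /=; rewrite lee_fin normrM [leRHS]normrM mulrC.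
apply: ler_pM => //; first by rewrite (le_trans (gM x))// ler_norm.
by rewrite (le_trans (vw x))// ler_norm.
Qed.

Lemma weighted_integrable (g : T -> R) (M : R) : measurable_fun setT g ->
  (forall x, `|g x| <= M) -> mu.-integrable setT (EFin \o (fun x => w x * g x)).
Proof. by apply: dominated_integrable => // x; rewrite ger0_norm. Qed.

Lemma measurable_a x : measurable_fun setT (a x).
Proof. exact: (measurable_fun_pair2 x ma). Qed.

Lemma accept_integrable x (g : T -> R) (M : R) : measurable_fun setT g ->
  (forall x, `|g x| <= M) -> mu.-integrable setT (EFin \o (fun z => a x z * g z)).
Proof.
move=> mg gM; apply: (@bounded_integrableT _ M).
  by apply: measurable_funM => //; exact: measurable_a.
move=> z; rewrite normrM -[leRHS]mul1r ler_pM//.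
by have /andP[? ?] := a01 x z; rewrite ger0_norm.
Qed.

Lemma measurable_move (g : T -> R) : measurable_fun setT g ->
  (forall x, 0 <= g x) -> measurable_fun setT (move g).
Proof.
move=> mg g0; apply: (measurable_comp measurableT) => //=.
apply: (@measurable_fun_fubini_tonelli_F _ _ _ _ _ mu
  (fun p => (a p.1 p.2 * g p.2)%:E)).
- apply/measurable_EFinP; apply: measurable_funM => //.
  exact: measurableT_comp.
- by move=> p; rewrite lee_fin mulr_ge0//; have /andP[] := a01 p.1 p.2.
Qed.

Lemma move_ge0 (g : T -> R) x : (forall x, 0 <= g x) -> 0 <= move g x.
Proof.
move=> g0; apply: Rintegral_ge0 => z _; rewrite mulr_ge0//.
by have /andP[] := a01 x z.
Qed.

Lemma norm1_unit (g : T -> R) : (forall x, 0 <= g x <= 1) -> forall x, `|g x| <= 1.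
Proof. by move=> g01 x; have /andP[? ?] := g01 x; rewrite ger0_norm. Qed.

Lemma move_le (g : T -> R) x : measurable_fun setT g -> (forall x, 0 <= g x <= 1) ->
  move g x <= move (cst 1) x.
Proof.
move=> mg g01; apply: le_Rintegral => //.
- by apply: accept_integrable => //; exact: norm1_unit.
- by apply: (@accept_integrable _ _ 1) => // y /=; rewrite normr1.
- by move=> z _; rewrite ler_wpM2l//; have /andP[] := a01 x z; have /andP[] := g01 z.
Qed.

Lemma move1_le1 x : move (cst 1) x <= 1.
Proof.
rewrite -[leRHS](Rintegral_probability_cst mu).
apply: le_Rintegral => //.
- by apply: (@accept_integrable _ _ 1) => // y /=; rewrite normr1.
- by apply: (@bounded_integrableT _ 1) => // y /=; rewrite normr1.
- by move=> z _; rewrite mulr1; have /andP[] := a01 x z.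
Qed.

Lemma resample_01 (g : T -> R) x : measurable_fun setT g -> (forall x, 0 <= g x <= 1) ->
  0 <= resample g x <= 1.
Proof.
move=> mg g01; have /andP[gx0 gx1] := g01 x.
have m0 : 0 <= move g x by apply: move_ge0 => y; have /andP[] := g01 y.
have m1 := move_le x mg g01; have m2 := move1_le1 x.
rewrite /resample; nra.
Qed.

Lemma measurable_resample (g : T -> R) : measurable_fun setT g ->
  (forall x, 0 <= g x) -> measurable_fun setT (resample g).
Proof.
move=> mg g0; apply: measurable_funD; first exact: measurable_move.
apply: measurable_funM => //; apply: measurable_funB => //.
by apply: measurable_move => // x; exact: ler01.
Qed.

Lemma imh_step_EFin (g : T -> R) : measurable_fun setT g ->
  (forall x, 0 <= g x <= 1) ->
  imh_step mu a (EFin \o g) = EFin \o resample g.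
Proof.
move=> mg g01; apply/funext => x /=; rewrite /imh_step.
have g0 y : 0 <= g y by have /andP[] := g01 y.
under eq_integral.
  move=> z _; have /andP[? ?] := a01 x z.
  rewrite /= integral_uniform_if//; over.
have i1 := accept_integrable x mg (norm1_unit g01).
have ia : mu.-integrable setT (EFin \o (fun z => a x z * cst 1 z)).
  by apply: (@accept_integrable _ _ 1) => // y /=; rewrite normr1.
have i2 : mu.-integrable setT (EFin \o (fun z => (1 - a x z) * g x)).
  apply: (@bounded_integrableT _ 1).
    by apply: measurable_funM => //; apply: measurable_funB => //; exact: measurable_a.
  move=> z; have /andP[? ?] := a01 x z; have /andP[? ?] := g01 x.
  rewrite ger0_norm; nra.
rewrite -[LHS]fineK; last first.
  by apply: integrable_fin_num => //; exact: (integrableD measurableT i1 i2).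
congr EFin; rewrite -/(Rintegral mu setT (fun z => a x z * g z + (1 - a x z) * g x)).
rewrite RintegralD//; congr (_ + _).
rewrite RintegralZr//; last first.
  apply: (@bounded_integrableT _ 1).
    by apply: measurable_funB => //; exact: measurable_a.
  by move=> z; have /andP[? ?] := a01 x z; rewrite ger0_norm; lra.
congr (_ * _); rewrite RintegralB//.
- rewrite Rintegral_probability_cst; congr (_ - _).
  by apply: eq_Rintegral => z _; rewrite mulr1.
- by apply: (@bounded_integrableT _ 1) => // y /=; rewrite normr1.
- by apply: eq_integrable ia => // z _ /=; rewrite mulr1.
Qed.

Lemma iter_imh_step (g : T -> R) N : measurable_fun setT g ->
  (forall x, 0 <= g x <= 1) ->
  [/\ measurable_fun setT (iter N resample g),
      forall x, 0 <= iter N resample g x <= 1 &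
      iter N (imh_step mu a) (EFin \o g) = EFin \o iter N resample g].
Proof.
move=> mg g01; elim: N => [//|N [mN N01 IH]]; split => /=.
- by apply: measurable_resample => // x; have /andP[] := N01 x.
- by move=> x; exact: resample_01.
- by rewrite IH; exact: imh_step_EFin.
Qed.

(** Tonelli exchanges the current point and the proposal, and detailed balance carries the weight
    from one to the other: the flow into [g] equals the flow out of it. *)
Lemma weighted_move (g : T -> R) : measurable_fun setT g ->
  (forall x, 0 <= g x <= 1) ->
  \int[mu]_x (w x * move g x) = \int[mu]_x (w x * (move (cst 1) x * g x)).
Proof.
move=> mg g01; have g0 y : 0 <= g y by have /andP[] := g01 y.
have aC0 x z : 0 <= a x z by have /andP[] := a01 x z.
have outer (c : T -> R) (b : T -> T -> R) (x : T) : 0 <= c x ->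
    mu.-integrable setT (EFin \o b x) -> (forall z, 0 <= b x z) ->
    ((c x * \int[mu]_z b x z)%:E = \int[mu]_z (c x * b x z)%:E)%E.
  move=> cx0 ib b0; rewrite -RintegralZl// /Rintegral fineK//.
  apply: integrable_fin_num => //.
  under [X in _.-integrable _ X]eq_fun do rewrite EFinM.
  exact: integrableZl.
rewrite /Rintegral; congr fine.
transitivity (\int[mu]_x \int[mu]_z (w x * (a x z * g z))%:E)%E.
  apply: eq_integral => x _.
  rewrite (outer w (fun x z => a x z * g z))// => [|z]; last by rewrite mulr_ge0.
  exact: (accept_integrable x mg (norm1_unit g01)).
rewrite (@fubini_tonelli _ _ _ _ _ mu mu (fun p => (w p.1 * (a p.1 p.2 * g p.2))%:E)).
- apply: eq_integral => x _ /=.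
  have -> : w x * (move (cst 1) x * g x) = (w x * g x) * \int[mu]_z (a x z * cst 1 z).
    by rewrite mulrCA mulrA [RHS]mulrC mulrA.
  rewrite (outer (fun x => w x * g x) (fun x z => a x z * cst 1 z))//.
  + apply: eq_integral => z _; rewrite mulr1 mulrA detailed_balance.
    by congr EFin; ring.
  + by rewrite mulr_ge0.
  + by apply: (@accept_integrable _ _ 1) => // y /=; rewrite normr1.
  + by move=> z; rewrite mulr1.
- apply/measurable_EFinP; apply: measurable_funM => //.
    exact: measurableT_comp.
  by apply: measurable_funM => //; exact: measurableT_comp.
- by move=> p; rewrite lee_fin !mulr_ge0.
Qed.

(** Invariance of the law [w mu]: the two [move] terms cancel by [weighted_move]. *)
Lemma weighted_resample (g : T -> R) : measurable_fun setT g ->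
  (forall x, 0 <= g x <= 1) ->
  \int[mu]_x (w x * resample g x) = \int[mu]_x (w x * g x).
Proof.
move=> mg g01; have g0 y : 0 <= g y by have /andP[] := g01 y.
have m1g : measurable_fun setT (fun x => move (cst 1) x * g x).
  by apply: measurable_funM => //; apply: measurable_move => // y; exact: ler01.
have ig := weighted_integrable mg (norm1_unit g01).
have img : mu.-integrable setT (EFin \o (fun x => w x * move g x)).
  apply: (@weighted_integrable _ 1); first exact: measurable_move.
  move=> x; rewrite ger0_norm ?move_ge0//.
  exact: le_trans (move_le x mg g01) (move1_le1 x).
have i1g : mu.-integrable setT (EFin \o (fun x => w x * (move (cst 1) x * g x))).
  apply: (@weighted_integrable _ 1) => // x.
  have m10 : 0 <= move (cst 1) x by apply: move_ge0 => y; exact: ler01.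
  rewrite ger0_norm ?mulr_ge0//; have /andP[_ gx1] := g01 x.
  by rewrite -[leRHS]mul1r ler_pM// move1_le1.
transitivity (\int[mu]_x
    ((w x * move g x + w x * g x) - w x * (move (cst 1) x * g x))).
  by apply: eq_Rintegral => x _; rewrite /resample; ring.
rewrite RintegralB//; last exact: (integrableD measurableT img ig).
by rewrite RintegralD// weighted_move// addrAC subrr add0r.
Qed.

Lemma integrable_weight : mu.-integrable setT (EFin \o w).
Proof.
have : mu.-integrable setT (EFin \o (fun x => w x * cst 1 x)).
  by apply: (@weighted_integrable _ 1) => // x /=; rewrite normr1.
by apply: eq_integrable => // x _ /=; rewrite mulr1.
Qed.

Lemma weight_mass : \int[mu]_x w x = 1. Proof. by rewrite /Rintegral iw. Qed.

Lemma weighted_mean01 (g : T -> R) : measurable_fun setT g ->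
  (forall x, 0 <= g x <= 1) -> 0 <= \int[mu]_x (w x * g x) <= 1.
Proof.
move=> mg g01; apply/andP; split.
  by apply: Rintegral_ge0 => x _; have /andP[? _] := g01 x; exact: mulr_ge0.
rewrite -weight_mass; apply: le_Rintegral => //.
- exact: weighted_integrable mg (norm1_unit g01).
- exact: integrable_weight.
- by move=> x _; have /andP[_ ?] := g01 x; rewrite -[leRHS]mulr1 ler_wpM2l.
Qed.

(** * Partial minorization and contraction in weighted L^1 *)

Section minorization.
Context (u : T -> R) (delta : R).
Hypothesis measurable_u : measurable_fun setT u.
Hypothesis u0 : forall x, 0 <= u x.
Hypothesis uw : forall x, u x <= w x.
Hypothesis delta0 : 0 <= delta.
(** Where [u x = w x > 0], division by [w x] gives the Doeblin bound [delta * u z <= a x z]. Where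
    [u x = 0] the product form asks for nothing, which is how the bad region is exempted. *)
Hypothesis minor : forall x z, delta * (u x * u z) <= w x * a x z.

(** The part of the mass of [w mu] that the minorization misses. *)
Let eta := 1 - \int[mu]_x u x.

Lemma minor_integrable (g : T -> R) (M : R) : measurable_fun setT g ->
  (forall x, `|g x| <= M) -> mu.-integrable setT (EFin \o (fun x => u x * g x)).
Proof. by apply: dominated_integrable => // x; rewrite ger0_norm. Qed.

Lemma integrable_minor : mu.-integrable setT (EFin \o u).
Proof.
have : mu.-integrable setT (EFin \o (fun x => u x * cst 1 x)).
  by apply: (@minor_integrable _ 1) => // x /=; rewrite normr1.
by apply: eq_integrable => // x _ /=; rewrite mulr1.
Qed.

Lemma minor_mass : 0 <= eta <= 1.
Proof.
have w1 := weight_mass.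
have := le_Rintegral measurableT integrable_minor integrable_weight (fun x _ => uw x).
rewrite w1 => u1; have ui0 : 0 <= \int[mu]_x u x by apply: Rintegral_ge0.
rewrite /eta; lra.
Qed.

(** The density [w - u] is nonnegative with total mass [eta]. *)
Lemma deficit_le (g : T -> R) : measurable_fun setT g ->
  (forall x, `|g x| <= 1) ->
  `|\int[mu]_x (w x * g x) - \int[mu]_x (u x * g x)| <= eta.
Proof.
move=> mg g1; have w1 := weight_mass.
have iwg := weighted_integrable mg g1; have iug := minor_integrable mg g1.
have iwu : mu.-integrable setT (EFin \o (fun x => w x - u x)).
  exact: (integrableB measurableT integrable_weight integrable_minor).
have iwug : mu.-integrable setT (EFin \o (fun x => w x * g x - u x * g x)).
  exact: (integrableB measurableT iwg iug).
rewrite -RintegralB// (le_trans (le_normr_Rintegral _ iwug))//.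
rewrite /eta -w1 -RintegralB//; [|exact: integrable_weight|exact: integrable_minor].
apply: le_Rintegral => //; first exact: (integrable_norm iwug).
move=> x _; rewrite -mulrBl normrM ger0_norm ?subr_ge0// -[leRHS]mulr1.
by rewrite ler_wpM2l ?subr_ge0.
Qed.

(** A Markov kernel fixes constants; the right side is [resample] of the centred function,
    unfolded. *)
Lemma resample_sub (g : T -> R) (p : R) x : measurable_fun setT g ->
  (forall x, 0 <= g x <= 1) ->
  resample g x - p = move (fun z => g z - p) x + (1 - move (cst 1) x) * (g x - p).
Proof.
move=> mg g01; suff -> : move (fun z => g z - p) x = move g x - move (cst 1) x * p.
  by rewrite /resample; ring.
have i1 : mu.-integrable setT (EFin \o (fun z => a x z * cst 1 z)).
  by apply: (@accept_integrable _ _ 1) => // y /=; rewrite normr1.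
have i1p : mu.-integrable setT (EFin \o (fun z => a x z * cst p z)).
  exact: (@accept_integrable _ _ `|p|).
have ig := accept_integrable x mg (norm1_unit g01).
rewrite /move -RintegralZr//.
transitivity (\int[mu]_z (a x z * g z - a x z * cst p z)).
  by apply: eq_Rintegral => z _; rewrite mulrBr.
by rewrite RintegralB//; congr (_ - _); apply: eq_Rintegral => z _ /=; rewrite mulr1.
Qed.

(** Split [w x * a x z] into [delta * (u x * u z)] and a nonnegative remainder. The triangle
    inequality is spent on the remainder only, so the cancellation inside the integral of [u f]
    survives as the gain, the term with factor [delta]. *)
Lemma norm_weighted_move_le (f : T -> R) x : measurable_fun setT f ->
  (forall x, `|f x| <= 1) ->
  w x * `|move f x| <= w x * move (fun z => `|f z|) x
    + delta * (`|\int[mu]_z (u z * f z)| - \int[mu]_z (u z * `|f z|)) * u x.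
Proof.
move=> mf f1.
have mnf : measurable_fun setT (fun z => `|f z|) by exact: measurableT_comp.
have nf1 y : `| `|f y| | <= 1 by rewrite normr_id.
have ua (h : T -> R) : measurable_fun setT h -> (forall x, `|h x| <= 1) ->
    mu.-integrable setT (EFin \o (fun z => w x * (a x z * h z) - delta * u x * (u z * h z)))
    /\ w x * move h x - delta * u x * \int[mu]_z (u z * h z) =
       \int[mu]_z ((w x * a x z - delta * (u x * u z)) * h z).
  move=> mh h1; have ia := accept_integrable x mh h1; have iu := minor_integrable mh h1.
  have iwa : mu.-integrable setT (EFin \o (fun z => w x * (a x z * h z))).
    exact: (integrableZl measurableT _ ia).
  have idu : mu.-integrable setT (EFin \o (fun z => delta * u x * (u z * h z))).
    exact: (integrableZl measurableT _ iu).
  split; first exact: (integrableB measurableT iwa idu).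
  rewrite -!RintegralZl// -RintegralB//.
  by apply: eq_Rintegral => z _; ring.
have [if_ ef] := ua f mf f1; have [_ enf] := ua _ mnf nf1.
have : `|w x * move f x - delta * u x * \int[mu]_z (u z * f z)| <=
    w x * move (fun z => `|f z|) x - delta * u x * \int[mu]_z (u z * `|f z|).
  rewrite ef enf.
  have if' : mu.-integrable setT
      (EFin \o (fun z => (w x * a x z - delta * (u x * u z)) * f z)).
    by apply: eq_integrable if_ => // z _ /=; congr EFin; ring.
  rewrite (le_trans (le_normr_Rintegral _ if'))// le_eqVlt; apply/orP; left.
  apply/eqP; apply: eq_Rintegral => z _.
  by rewrite normrM ger0_norm// subr_ge0.
rewrite -[X in X * `|_|]ger0_norm// -normrM => le1.
have := ler_normD (w x * move f x - delta * u x * \int[mu]_z (u z * f z))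
  (delta * u x * \int[mu]_z (u z * f z)).
rewrite subrK [X in _ <= _ + X]normrM (ger0_norm (mulr_ge0 delta0 (u0 x))).
move=> le2; apply: (le_trans le2); move: le1; lra.
Qed.

(* The part [delta (u mu)] of the kernel forgets the starting point, and [g - p]
   has mean zero, so that part contributes only through the deficit [eta]. *)
Lemma resample_contraction (g : T -> R) (p : R) : measurable_fun setT g ->
  (forall x, 0 <= g x <= 1) -> p = \int[mu]_x (w x * g x) ->
  \int[mu]_x (w x * `|resample g x - p|) - 2 * eta <=
  (1 - delta * (1 - eta)) * (\int[mu]_x (w x * `|g x - p|) - 2 * eta).
Proof.
move=> mg g01 pE; have w1 := weight_mass.
have iwg := weighted_integrable mg (norm1_unit g01).
have /andP[p0 p1] : 0 <= p <= 1 by rewrite pE; exact: weighted_mean01.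
pose f x := g x - p.
have mf : measurable_fun setT f by exact: measurable_funB.
have f1 x : `|f x| <= 1.
  by have /andP[? ?] := g01 x; rewrite /f ler_norml; lra.
have mnf : measurable_fun setT (fun z => `|f z|) by exact: measurableT_comp.
have nf01 x : 0 <= `|f x| <= 1 by rewrite normr_ge0 f1.
have wf0 : \int[mu]_x (w x * f x) = 0.
  transitivity (\int[mu]_x (w x * g x - w x * p)).
    by apply: eq_Rintegral => x _; rewrite mulrBr.
  rewrite RintegralB//; last by apply: (@weighted_integrable (cst p) `|p|).
  by rewrite RintegralZr ?w1 -?pE ?mul1r ?subrr//; exact: integrable_weight.
set c := delta * (`|\int[mu]_z (u z * f z)| - \int[mu]_z (u z * `|f z|)).
have mrnf : measurable_fun setT (resample (fun z => `|f z|)).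
  by apply: measurable_resample.
have irnf : mu.-integrable setT (EFin \o (fun x => w x * resample (fun z => `|f z|) x)).
  by apply: (@weighted_integrable _ 1) => // x; apply: norm1_unit => y; exact: resample_01.
have icu : mu.-integrable setT (EFin \o (fun x => c * u x)).
  exact: (integrableZl measurableT _ integrable_minor).
have mr : measurable_fun setT (resample g).
  by apply: measurable_resample => // x; have /andP[] := g01 x.
have le1 : \int[mu]_x (w x * `|resample g x - p|) <=
    \int[mu]_x (w x * resample (fun z => `|f z|) x + c * u x).
  apply: le_Rintegral => //.
  - apply: (@weighted_integrable _ 1).
      by apply: measurableT_comp => //; exact: measurable_funB.
    move=> x; rewrite normr_id; have /andP[? ?] := resample_01 x mg g01.
    by rewrite ler_norml; lra.
  - exact: (integrableD measurableT irnf icu).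
  - move=> x _; rewrite resample_sub//.
    apply: (@le_trans _ _ (w x * (`|move f x| + (1 - move (cst 1) x) * `|f x|))).
      rewrite ler_wpM2l// (le_trans (ler_normD _ _))// lerD2l normrM.
      by rewrite [X in X * _]ger0_norm// subr_ge0 move1_le1.
    have := norm_weighted_move_le x mf f1; rewrite -/c /resample.
    by lra.
(* Invariance applied to [|f|] returns the old distance, so the whole improvement is [c] times the
   mass [1 - eta] of [u]. *)
have e1 : \int[mu]_x (w x * resample (fun z => `|f z|) x + c * u x) =
    \int[mu]_x (w x * `|f x|) + c * (1 - eta).
  rewrite RintegralD// weighted_resample// RintegralZl//; last exact: integrable_minor.
  by congr (_ + c * _); rewrite /eta; ring.
have du := deficit_le mf f1.
have dnu := deficit_le mnf (norm1_unit nf01).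
rewrite wf0 sub0r normrN in du.
have /andP[eta0 eta1] := minor_mass.
(* Two deficits make up [2 * eta]: the integral of [u f] is within [eta] of the vanishing integral
   of [w f], and that of [u |f|] is within [eta] of the distance. *)
have cle : c <= delta * (2 * eta - \int[mu]_x (w x * `|f x|)).
  rewrite /c ler_wpM2l//; move: dnu; rewrite ler_norml => /andP[_]; lra.
have := ler_wpM2r (_ : 0 <= 1 - eta) cle; rewrite subr_ge0 => /(_ eta1).
rewrite -/(f _) in le1 *; move: le1; rewrite e1; nra.
Qed.

(** Subtracting the fixed point [2 * eta] turns the one-step bound into a purely geometric
    recursion, started from a distance of at most one. *)
Lemma iter_resample_contraction (g : T -> R) (p : R) N : measurable_fun setT g ->
  (forall x, 0 <= g x <= 1) -> p = \int[mu]_x (w x * g x) ->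
  delta <= 1 ->
  \int[mu]_x (w x * `|iter N resample g x - p|) <=
  (1 - delta * (1 - eta)) ^+ N + 2 * eta.
Proof.
move=> mg g01 pE delta1; have /andP[eta0 eta1] := minor_mass.
have w1 := weight_mass.
have rho0 : 0 <= 1 - delta * (1 - eta) by nra.
have it n : [/\ measurable_fun setT (iter n resample g),
    forall x, 0 <= iter n resample g x <= 1 &
    p = \int[mu]_x (w x * iter n resample g x)].
  elim: n => [//|n [mn n01 IH]]; split => /=.
  - by apply: measurable_resample => // x; have /andP[] := n01 x.
  - by move=> x; exact: resample_01.
  - by rewrite weighted_resample.
have p01 : 0 <= p <= 1 by rewrite pE; exact: weighted_mean01.
rewrite -lerBlDr; elim: N => [|N IH] /=.
  rewrite expr0 (@le_trans _ _ (\int[mu]_x (w x * `|g x - p|)))//.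
    by rewrite lerBlDr lerDl mulr_ge0.
  rewrite -w1; apply: le_Rintegral => //.
  - apply: (@weighted_integrable _ 1).
      by apply: measurableT_comp => //; exact: measurable_funB.
    move=> x; rewrite normr_id; have /andP[? ?] := g01 x; have /andP[? ?] := p01.
    by rewrite ler_norml; lra.
  - exact: integrable_weight.
  - move=> x _; rewrite -[leRHS]mulr1 ler_wpM2l// ler_norml.
    by have /andP[? ?] := g01 x; have /andP[? ?] := p01; lra.
have [mN N01 pN] := it N.
rewrite (le_trans (resample_contraction mN N01 pN))// exprS.
exact: ler_wpM2l.
Qed.

Lemma imh_law_deviation (A : set T) (M : R) N : measurable A -> delta <= 1 ->
  0 <= M ->
  (`|imh_law mu a N A - (\int[mu]_x (w x * \1_A x))%:E| <=
   (M * ((1 - delta * (1 - eta)) ^+ N + 2 * eta)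
    + fine (mu [set x | M * w x < 1]))%:E)%E.
Proof.
move=> mA delta1 M0; set p := Rintegral _ _ _.
have m1 : measurable_fun setT (\1_A : T -> R) by exact: measurable_indic.
have i01 x : 0 <= (\1_A x : R) <= 1 by rewrite indicE; case: (_ \in _); rewrite ?lexx ?ler01.
have [mh h01 hE] := iter_imh_step N m1 i01.
have p01 : 0 <= p <= 1 by exact: weighted_mean01.
rewrite /imh_law -[fun y => (\1_A y)%:E]/(EFin \o \1_A) hE.
set h := iter N resample _ in mh h01 *.
have ih : mu.-integrable setT (EFin \o h) by exact: bounded_integrableT (norm1_unit h01).
have ihp : mu.-integrable setT (EFin \o (fun x => h x - p)).
  apply: (integrableB measurableT ih (g := cst p%:E)).
  exact: finite_measure_integrable_cst.
rewrite -[X in (X - _)%E]fineK; last exact: integrable_fin_num.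
rewrite -EFinB lee_fin.
have -> : fine (\int[mu]_x (EFin \o h) x)%E - p = \int[mu]_x (h x - p).
  by rewrite RintegralB ?Rintegral_probability_cst//; exact: finite_measure_integrable_cst.
set B := [set x | M * w x < 1].
have mB : measurable B.
  have mMw : measurable_fun setT (fun x => M * w x) by exact: measurable_funM.
  exact: (measurable_set_ltr mMw (measurable_cst (1 : R))).
have mhp : measurable_fun setT (fun x => `|h x - p|).
  by apply: measurableT_comp => //; exact: measurable_funB.
have hp1 x : `|h x - p| <= 1.
  by have /andP[? ?] := h01 x; have /andP[? ?] := p01; rewrite ler_norml; lra.
have iwh : mu.-integrable setT (EFin \o (fun x => w x * `|h x - p|)).
  by apply: (@weighted_integrable _ 1) => // x; rewrite normr_id.
have iMwh : mu.-integrable setT (EFin \o (fun x => M * (w x * `|h x - p|))).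
  exact: (integrableZl measurableT _ iwh).
have iB : mu.-integrable setT (EFin \o (\1_B : T -> R)) by exact: integrable_indic.
rewrite (le_trans (le_normr_Rintegral _ ihp))//.
(* Off [B] one has [1 <= M * w x]; on [B] the deviation is at most one because [h x] and [p] lie in
   the unit interval. *)
apply: (@le_trans _ _ (\int[mu]_x (M * (w x * `|h x - p|) + \1_B x))).
  apply: le_Rintegral => //; first exact: (integrable_norm ihp).
    exact: (integrableD measurableT iMwh iB).
  move=> x _; rewrite indicE; have [Bx|] := boolP (x \in B).
    by rewrite (le_trans (hp1 x))// lerDr !mulr_ge0.
  rewrite notin_setE /B /= => /negP; rewrite -leNgt => Mw.
  by rewrite addr0 mulrA ler_peMl.
rewrite RintegralD// RintegralZl// lerD//.
  rewrite ler_wpM2l//; apply: iter_resample_contraction => //.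
by rewrite /Rintegral integral_indic// setIT.
Qed.

End minorization.

End reversible_resampling.

(** * Densities, change of measure and Renyi moments *)

Lemma measurable_fun_divr d (T : measurableType d) (R : realType) (f g : T -> R) :
  measurable_fun setT f -> measurable_fun setT g -> (forall x, 0 <= g x) ->
  measurable_fun setT (fun x => f x / g x).
Proof.
(* Inverse and power [-1] agree at 0 as well, both having the value 0 there. *)
move=> mf mg g0; under eq_fun do rewrite -powR_inv1//.
apply: measurable_funM => //.
exact: (measurableT_comp (measurable_powR (-1)) mg).
Qed.

Lemma measurable_zeros d (T : measurableType d) (R : realType) (f : T -> R) :
  measurable_fun setT f -> measurable [set x | f x = 0].
Proof.
move=> mf; rewrite -[X in measurable X]setTI.
exact: (mf measurableT [set 0] (measurable_set1 0)).
Qed.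

Section density.
Context d (T : measurableType d) (R : realType).
Context (lam nu : {measure set T -> \bar R}) (p : T -> R).
Hypothesis mp : measurable_fun setT p.
Hypothesis p0 : forall x, 0 <= p x.
Hypothesis nuE : forall A, measurable A -> nu A = (\int[lam]_(x in A) (p x)%:E)%E.

Import HBNNSimple.

(** The density is given only through the values of [nu] on sets, so the formula is checked on
    simple functions and extended by monotone convergence. *)
Lemma integral_density (g : T -> R) : measurable_fun setT g ->
  (forall x, 0 <= g x) ->
  (\int[nu]_x (g x)%:E = \int[lam]_x (g x * p x)%:E)%E.
Proof.
move=> mg g0.
have mEg : measurable_fun setT (EFin \o g) by exact/measurable_EFinP.
pose h := nnsfun_approx measurableT mEg.
have hg x : (EFin \o h n) x @[n --> \oo] --> (g x)%:E.
  by apply: (cvg_nnsfun_approx measurableT mEg) => // y _; rewrite lee_fin.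
transitivity (limn (fun n => \int[nu]_x (h n x)%:E)%E).
  rewrite -monotone_convergence//.
  - by apply: eq_integral => x _; apply/esym/cvg_lim => //; exact: hg.
  - by move=> n; exact/measurable_EFinP.
  - by move=> n x _; rewrite lee_fin.
  - by move=> x _ m n mn; rewrite lee_fin; exact/lefP/nd_nnsfun_approx.
transitivity (limn (fun n => \int[lam]_x ((h n x)%:E * (p x)%:E))%E); last first.
  rewrite -monotone_convergence//.
  - apply: eq_integral => x _; apply/cvg_lim => //; rewrite EFinM.
    by apply: cvgeZr => //; exact: hg.
  - by move=> n; apply: emeasurable_funM; exact/measurable_EFinP.
  - by move=> n x _; rewrite mule_ge0 ?lee_fin.
  - move=> x _ m n mn; rewrite lee_wpmul2r ?lee_fin//.
    exact/lefP/nd_nnsfun_approx.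
congr (limn _); apply/funext => n.
transitivity (\int[nu]_x (\sum_(y \in range (h n)) (y * \1_(h n @^-1` [set y]) x)%:E))%E.
  by apply: eq_integral => x _; rewrite /= fimfunE -fsumEFin.
have mi r : measurable_fun setT (fun x => (r * \1_(h n @^-1` [set r]) x)%:E).
  by apply/measurable_EFinP; apply: measurable_funM.
rewrite ge0_integral_fsum//; last by move=> y x _; rewrite EFinM nnfun_muleindic_ge0.
transitivity (\int[lam]_x (\sum_(y \in range (h n))
    (y * \1_(h n @^-1` [set y]) x)%:E * (p x)%:E))%E; last first.
  apply: eq_integral => x _; rewrite -ge0_mule_fsuml => [|y]; last by rewrite EFinM nnfun_muleindic_ge0.
  by rewrite fsumEFin// -(fimfunE _ x).
rewrite ge0_integral_fsum//; last 2 first.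
- by move=> y; apply: emeasurable_funM => //; exact/measurable_EFinP.
- by move=> y x _; rewrite mule_ge0// ?lee_fin//; rewrite -lee_fin EFinM nnfun_muleindic_ge0.
apply: eq_fsbigr => r; rewrite inE => -[t _ <-].
under eq_integral do rewrite EFinM.
rewrite ge0_integralZl ?lee_fin//; last exact/measurable_EFinP.
under [RHS]eq_integral do rewrite EFinM -muleA.
rewrite [RHS]ge0_integralZl ?lee_fin//; last 2 first.
- by apply: emeasurable_funM; exact/measurable_EFinP.
- by move=> x _; rewrite mule_ge0 ?lee_fin.
congr (_ * _)%E; rewrite integral_indic// setIT nuE//.
rewrite integral_mkcond; apply: eq_integral => x _.
by rewrite patchE indicE; case: ifP => _; rewrite ?mul1e ?mul0e.
Qed.

Lemma density_null : nu [set x | p x = 0] = 0%E.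
Proof.
have mZ : measurable [set x | p x = 0] by exact: measurable_zeros.
by rewrite nuE//; apply: integral0_eq => x /= ->.
Qed.

Context (f : T -> R).
Hypothesis mf : measurable_fun setT f.
Hypothesis f0 : forall x, 0 <= f x.

Let F (q : R) x : \bar R := if f x == 0%R then (if p x == 0%R then 0%E else +oo%E)
  else ((p x / f x) `^ q * f x)%:E.

Let F_ge0 q x : (0 <= F q x)%E.
Proof.
by rewrite /F; do 2?[case: ifP => // _]; rewrite lee_fin mulr_ge0// powR_ge0.
Qed.

Let measurable_F q : measurable_fun setT (F q).
Proof.
apply: measurable_fun_ifT; first exact: measurable_fun_eqr.
  by apply: measurable_fun_ifT => //; exact: measurable_fun_eqr.
apply/measurable_EFinP; apply: measurable_funM => //.
apply: (measurableT_comp (measurable_powR q)).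
exact: measurable_fun_divr.
Qed.

Lemma renyi_moment_le (q b : R) : 1 < q -> (renyi lam p f q <= b%:E)%E ->
  (\int[lam]_x F q x <= (expR ((q - 1) * b))%:E)%E.
Proof.
move=> q1; rewrite /renyi gt_eqF//= -/(F q).
have : (0 <= \int[lam]_x F q x)%E by exact: integral_ge0.
case: (integral lam setT (F q)) => [r|//|//]; rewrite ?lee_fin//= => r0.
rewrite ler_pdivrMl ?subr_gt0//.
(* A zero moment is set apart, since [ln] takes a default value at 0 and cannot be inverted
   there. *)
move: r0; rewrite le_eqVlt => /predU1P[<- _|r0]; first exact: expR_ge0.
by rewrite -{2}(lnK r0) ler_expR.
Qed.

(** Common core of Markov's inequality and of absolute continuity, which differ only in the factor
    [k]. *)
Lemma density_le_moment (q k : R) (S : set T) : measurable S -> 0 <= k ->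
  (forall x, S x -> ((p x)%:E <= k%:E * F q x)%E) ->
  (nu S <= k%:E * \int[lam]_x F q x)%E.
Proof.
move=> mS k0 pF; rewrite nuE// -ge0_integralZl//.
apply: (@le_trans _ _ (\int[lam]_(x in S) (k%:E * F q x))%E).
  apply: ge0_le_integral => //.
  - by move=> x _; rewrite lee_fin.
  - by apply/measurable_EFinP; exact: measurable_funTS.
  - by apply: measurable_funTS; exact: emeasurable_funM.
apply: ge0_subset_integral => //; first exact: emeasurable_funM.
by move=> x _; rewrite mule_ge0 ?lee_fin.
Qed.

(** On [f = 0 < p] the moment integrand is infinite, so it dominates [p] after multiplication by any
    [k > 0]; a finite moment and [k] tending to 0 leave no mass. *)
Lemma renyi_abs_cont (q b : R) : 1 < q -> (renyi lam p f q <= b%:E)%E ->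
  nu [set x | f x = 0] = 0%E.
Proof.
move=> q1 /(renyi_moment_le q1) IE.
have mZ : measurable [set x | f x = 0] by exact: measurable_zeros.
apply/eqP; rewrite eq_le measure_ge0 andbT; apply/lee_addgt0Pr => e e0.
set E := expR _ in IE; have E0 : 0 < E by exact: expR_gt0.
rewrite add0e (@le_trans _ _ ((e / E)%:E * \int[lam]_x F q x)%E)//.
  apply: density_le_moment => //; first by rewrite divr_ge0// ltW.
  move=> x /= fx0; rewrite /F fx0 eqxx; case: eqP => [->|_]; first by rewrite mule0.
  by rewrite gt0_muley ?leey// lte_fin divr_gt0.
apply: (@le_trans _ _ ((e / E)%:E * E%:E)%E).
  by rewrite lee_wpmul2l// lee_fin divr_ge0// ltW.
by rewrite -EFinM divfK// gt_eqF.
Qed.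

(* Markov: on [M f < p] one has [p <= M^(1-q) (p/f)^q f]. *)
Lemma renyi_tail (q b M : R) : 1 < q -> 0 < M -> (renyi lam p f q <= b%:E)%E ->
  (nu [set x | (M * f x < p x)%R] <= (expR ((q - 1) * b) / M `^ (q - 1))%:E)%E.
Proof.
move=> q1 M0 /(renyi_moment_le q1) IE.
have mS : measurable [set x | M * f x < p x].
  by apply: measurable_set_ltr => //; exact: measurable_funM.
have Mq0 : 0 < M `^ (q - 1) by exact: powR_gt0.
rewrite mulrC EFinM (@le_trans _ _ ((M `^ (q - 1))^-1%:E * \int[lam]_x F q x)%E)//.
  apply: density_le_moment => //; first by rewrite invr_ge0 ltW.
  move=> x /= Mfp; have px0 : 0 < p x by rewrite (le_lt_trans _ Mfp)// mulr_ge0// ltW.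
  rewrite /F; have [fx0|fx0] := eqVneq (f x) 0.
    by rewrite gt_eqF// gt0_muley ?leey// lte_fin invr_gt0.
  have fx : 0 < f x by rewrite lt_neqAle eq_sym fx0/=.
  rewrite -EFinM lee_fin ler_pdivlMl//.
  have t0 : p x / f x != 0 by rewrite gt_eqF// divr_gt0.
  have -> : (p x / f x) `^ q = (p x / f x) `^ (q - 1) * (p x / f x).
    by rewrite -{3}(powRr1 (divr_ge0 (p0 x) (f0 x))) -powRD ?subrK// t0 implybT.
  rewrite -mulrA divfK// ler_wpM2r// ge0_ler_powR ?nnegrE//.
  - by rewrite subr_ge0 ltW.
  - exact: ltW.
  - exact: divr_ge0.
  - by rewrite ler_pdivlMr// ltW.
by rewrite lee_wpmul2l// lee_fin invr_ge0 ltW.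
Qed.

End density.

(** * The Metropolis-Hastings kernel with its density ratio *)

Section imh.
Context d (T : measurableType d) (R : realType).
Context (pid mud : T -> R).
Hypothesis mpid : measurable_fun setT pid.
Hypothesis mmud : measurable_fun setT mud.
Hypothesis pid0 : forall x, 0 <= pid x.
Hypothesis mud0 : forall x, 0 <= mud x.

Let w x := pid x / mud x.

(** No positivity is required because [0^-1 = 0] and inversion is multiplicative. When [w x = 0] the
    acceptance is 0 and the chain stays at [x]; such starting points fall into the set
    [M * w x < 1]. *)
Lemma imh_accept_ratio x z :
  imh_accept pid mud x z = 2^-1 * Num.min 1 (w z / w x).
Proof. by rewrite /imh_accept /w !invfM !invrK; congr (_ * Num.min _ _); ring. Qed.

Let w0 x : 0 <= w x. Proof. exact: divr_ge0. Qed.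

Lemma imh_accept_balance x z :
  w x * imh_accept pid mud x z = 2^-1 * Num.min (w x) (w z).
Proof.
rewrite imh_accept_ratio mulrCA; congr (_ * _).
have [->|wx] := eqVneq (w x) 0; first by rewrite mul0r min_l.
by rewrite minr_pMr// mulr1 mulrCA divff// mulr1.
Qed.

Lemma imh_accept01 x z : 0 <= imh_accept pid mud x z <= 1.
Proof.
rewrite imh_accept_ratio; have r0 : 0 <= w z / w x by exact: divr_ge0.
have m0 : 0 <= Num.min 1 (w z / w x) by rewrite le_min ler01.
have m1 : Num.min 1 (w z / w x) <= 1 by rewrite ge_min lexx.
lra.
Qed.

Let mw : measurable_fun setT w. Proof. exact: measurable_fun_divr. Qed.

Lemma measurable_imh_accept :
  measurable_fun [set: T * T] (fun s => imh_accept pid mud s.1 s.2).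
Proof.
under eq_fun do rewrite imh_accept_ratio.
apply: measurable_funM => //; apply: measurable_minr => //.
apply: measurable_fun_divr => //; exact: measurableT_comp.
Qed.

Context (lam : {measure set T -> \bar R}) (mu pi : probability T R).
Hypothesis muE : forall A, measurable A -> mu A = (\int[lam]_(x in A) (mud x)%:E)%E.
Hypothesis piE : forall A, measurable A -> pi A = (\int[lam]_(x in A) (pid x)%:E)%E.
Hypothesis pi_ac : pi [set x | mud x = 0] = 0%E.

(** Where [mud] vanishes, [w] is 0 by convention and the left side sees nothing; [pi_ac] ensures
    that [pi] has no mass there either. *)
Lemma ratio_density (A : set T) : measurable A ->
  (\int[mu]_x (w x * \1_A x)%:E = pi A)%E.
Proof.
move=> mA; have mZ : measurable [set x | mud x = 0] by exact: measurable_zeros.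
have mAZ : measurable (A `\` [set x | mud x = 0]) by exact: measurableD.
rewrite (integral_density mmud mud0 muE); last 2 first.
- exact: measurable_funM.
- by move=> x; rewrite mulr_ge0.
transitivity (pi (A `\` [set x | mud x = 0])); last first.
  have AZ0 : pi (A `&` [set x | mud x = 0%R]) = 0%E.
    apply/eqP; rewrite eq_le measure_ge0 andbT.
    by rewrite -pi_ac le_measure ?inE//; exact: measurableI.
  have piAE : (pi A - pi (A `&` [set x | mud x = 0%R]) = pi A)%E by rewrite AZ0 sube0.
  rewrite measureD//.
  exact: (le_lt_trans (probability_le1 pi mA) (ltry 1)).
rewrite piE// [RHS]integral_mkcond; apply: eq_integral => x _.
rewrite patchE indicE /w; have [Ax|Ax] := boolP (x \in A); last first.
  by rewrite mulr0 mul0r ifF//; apply/negbTE; rewrite notin_setE => -[/mem_set]; rewrite (negbTE Ax).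
rewrite mulr1; case: ifPn => [|].
  by rewrite inE/= => -[_ /eqP mx]; rewrite divfK.
rewrite notin_setE/= => mx; have -> : mud x = 0.
  by apply: contrapT => mx0; apply: mx; split => //; exact: set_mem.
by rewrite mulr0.
Qed.

Lemma imh_law_tail_bound (M t : R) N (A : set T) : 1 <= M -> t <= 1 ->
  (pi [set x | (M * mud x < pid x)%R] <= t%:E)%E ->
  (mu [set x | (M * pid x < mud x)%R] <= t%:E)%E ->
  measurable A ->
  (`|imh_law mu (imh_accept pid mud) N A - pi A| <=
    (M * ((1 - (2 * M)^-1 * (1 - t)) ^+ N + 2 * t) + t)%:E)%E.
Proof.
move=> M1 t1 pit mut mA; have M0 : 0 < M by exact: lt_le_trans M1.
have iw : (\int[mu]_x (w x)%:E = 1)%E.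
  rewrite -(@probability_setT _ _ _ pi) -ratio_density//.
  by apply: eq_integral => x _; rewrite indicT mulr1.
pose G := [set x | M < w x].
have mG : measurable G by apply: measurable_set_ltr.
pose u x := w x * \1_(~` G) x.
have mu_ : measurable_fun setT u.
  by apply: measurable_funM => //; apply: measurable_indic; exact: measurableC.
have i0 x : 0 <= (\1_(~` G) x : R) by rewrite indicE.
have i1 x : (\1_(~` G) x : R) <= 1 by rewrite indicE; case: (_ \in _).
have u0 x : 0 <= u x by exact: mulr_ge0.
have uw x : u x <= w x by rewrite -[leRHS]mulr1 ler_wpM2l.
have uM x : u x <= M.
  rewrite /u indicE; case: (boolP (x \in ~` G)) => [|_]; last by rewrite mulr0 ltW.
  by rewrite inE /G /= mulr1 => /negP; rewrite -leNgt.
set delta := (2 * M)^-1; have delta0 : 0 < delta by rewrite invr_gt0 mulr_gt0.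
have delta1 : delta <= 1 by rewrite invf_le1 ?mulr_gt0//; lra.
(* Each factor [u] is at most [M] and at most its own weight, so the product is at most [M] times
   either weight; the remaining 1/2 of [delta] is the laziness of the acceptance rule. *)
have minor x z : delta * (u x * u z) <= w x * imh_accept pid mud x z.
  rewrite imh_accept_balance /delta invfM -mulrA ler_wpM2l ?invr_ge0//.
  rewrite ler_pdivrMl// minr_pMr ?(ltW M0)// le_min; apply/andP; split.
    by rewrite mulrC ler_pM.
  by rewrite ler_pM.
have bal x z : w x * imh_accept pid mud x z = w z * imh_accept pid mud z x.
  by rewrite !imh_accept_balance minC.
set eta := 1 - \int[mu]_x u x.
have etat : eta <= t.
  have mGC : measurable (~` G) by exact: measurableC.
  have -> : eta = fine (pi G).
    rewrite /eta /u /Rintegral ratio_density// probability_setC//.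
    by rewrite fineB ?fin_num_measure//= opprB addrCA subrr addr0.
  rewrite -lee_fin fineK ?fin_num_measure// (le_trans _ pit)// le_measure ?inE//.
    by apply: measurable_set_ltr => //; exact: measurable_funM.
  (* Zeros of [mud] have [w x = 0] and so lie outside [G]; elsewhere the denominator can be
     cleared. *)
  move=> x; rewrite /G /w /=; have [->|mx] := eqVneq (mud x) 0.
    by rewrite invr0 mulr0 ltNge (ltW M0).
  by rewrite ltr_pdivlMr// lt_neqAle eq_sym mx/=.
have eta01 : 0 <= eta <= 1 := minor_mass mw w0 iw mu_ u0 uw.
have tau : fine (mu [set x | M * w x < 1]) <= t.
  have mZ : measurable [set x | mud x = 0] by exact: measurable_zeros.
  have mS : measurable [set x | M * pid x < mud x].
    by apply: measurable_set_ltr => //; exact: measurable_funM.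
  have mB : measurable [set x | M * w x < 1].
    by apply: measurable_set_ltr => //; exact: measurable_funM.
  rewrite -lee_fin fineK ?fin_num_measure//.
  (* Here the zeros of [mud] do belong to the set, but they are [mu]-null. *)
  apply: (@le_trans _ _ (mu ([set x | mud x = 0%R] `|` [set x | (M * pid x < mud x)%R]))).
    rewrite le_measure ?inE//; first exact: measurableU.
    move=> x /=; have [->|mx] := eqVneq (mud x) 0; first by left.
    by right; move: H; rewrite /w mulrA ltr_pdivrMr ?mul1r// lt_neqAle eq_sym mx/=.
  apply: (@le_trans _ _ (mu [set x | mud x = 0%R] + mu [set x | (M * pid x < mud x)%R])%E).
    exact: measureU2.
  by rewrite (density_null mmud muE) add0e.
rewrite -(ratio_density mA).
have -> : (\int[mu]_x (w x * \1_A x)%:E = (\int[mu]_x (w x * \1_A x))%:E)%E.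
  by rewrite /Rintegral fineK// ratio_density// fin_num_measure.
have := imh_law_deviation measurable_imh_accept imh_accept01 mw w0 iw bal mu_ u0 uw
  (ltW delta0) minor N mA delta1 (ltW M0).
move/le_trans; apply; rewrite lee_fin -/eta lerD// ler_wpM2l ?(ltW M0)//.
apply: lerD; last by rewrite ler_wpM2l.
have /andP[eta0 eta1] := eta01.
apply: lerXn2r; rewrite ?nnegrE; nra.
Qed.

End imh.

(** * Error budget and choice of constants *)

Lemma imh_error_le (R : realType) (L t : R) (N : nat) : 4 <= L ->
  8 * expR 2 * L <= N%:R ->
  t = expR (1 - 3 * L) ->
  expR 2 * ((1 - (2 * expR 2)^-1 * (1 - t)) ^+ N + 2 * t) + t <= expR (- L).
Proof.
move=> L4 NL tE; have e2 : 0 < expR 2 :> R by exact: expR_gt0.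
have bound (x b : R) : 0 < b -> b <= 1 + x -> expR (- x) <= b^-1.
  move=> b0 bx; rewrite expRN lef_pV2 ?posrE ?expR_gt0//.
  exact: le_trans bx (expR_ge1Dx x).
have t0 : 0 < t by rewrite tE expR_gt0.
have t12 : t <= 2^-1.
  by rewrite tE -[1 - _]opprB; apply: bound => //; lra.
set delta := (2 * expR 2)^-1.
have delta0 : 0 < delta by rewrite invr_gt0 mulr_gt0.
have delta1 : delta <= 1.
  rewrite invf_le1 ?mulr_gt0//; have := @expR_ge1Dx R 2; lra.
(* As [t <= 1/2], the rate is at most [expR (- (delta / 2))] with [delta / 2 = 1 / (4 e^2)]; the
   factor [8 e^2] in the bound on [N] gives the exponent [2 * L]. *)
have rhoN : (1 - delta * (1 - t)) ^+ N <= expR (- (2 * L)).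
  apply: (@le_trans _ _ (expR (- (delta / 2)) ^+ N)).
    apply: lerXn2r; rewrite ?nnegrE ?expR_ge0//; first nra.
    apply: le_trans (expR_ge1Dx _); nra.
  rewrite -expRM_natl ler_expR mulrN lerN2.
  have : delta / 2 * (8 * expR 2 * L) <= delta / 2 * N%:R.
    by rewrite ler_wpM2l// divr_ge0// ltW.
  have -> : delta / 2 * (8 * expR 2 * L) = 2 * L.
    by rewrite /delta; field; rewrite gt_eqF.
  by rewrite (mulrC N%:R).
have eL : 0 < expR (- L) by exact: expR_gt0.
(* The terms receive the shares 1/3, twice 1/6, and 1/8 of [expR (- L)], with sum 19/24. Each share
   is [1 / (1 + x)] at [L = 4] for the surplus exponent [x]. *)
have s1 : expR 2 * expR (- (2 * L)) <= expR (- L) * 3^-1.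
  have -> : expR 2 * expR (- (2 * L)) = expR (- L) * expR (- (L - 2)).
    by rewrite ?tE -!expRD; congr expR; ring.
  by rewrite ler_wpM2l ?(ltW eL)//; apply: bound => //; lra.
have s2 : expR 2 * t <= expR (- L) * 6^-1.
  have -> : expR 2 * t = expR (- L) * expR (- (2 * L - 3)).
    by rewrite ?tE -!expRD; congr expR; ring.
  by rewrite ler_wpM2l ?(ltW eL)//; apply: bound => //; lra.
have s3 : t <= expR (- L) * 8^-1.
  have -> : t = expR (- L) * expR (- (2 * L - 1)).
    by rewrite ?tE -!expRD; congr expR; ring.
  by rewrite ler_wpM2l ?(ltW eL)//; apply: bound => //; lra.
have := ler_wpM2l (ltW e2) rhoN; lra.
Qed.

Theorem theorem3 (R : realType) (gamma : R) (hgamma : 0 < gamma) :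
  exists C : R, exists c : R, exists K : R, exists eps0 : R,
  [/\ 0 < C, 0 < c, 0 < K & 0 < eps0] /\
  forall (eps : R), 0 < eps -> eps < eps0 ->
  forall (CR : R), 0 < CR -> CR <= c * (ln (eps^-1)) `^ (- (gamma + 1)) ->
  forall (d : nat) (lam : {measure set (Rd R d) -> \bar R})
    (mu pi : probability (Rd R d) R) (mud pid : Rd R d -> R) (Ch : R),
  measurable_fun setT mud -> measurable_fun setT pid ->
  (forall x, 0 <= mud x) -> (forall x, 0 <= pid x) ->
  (forall A, measurable A -> mu A = (\int[lam]_(x in A) (mud x)%:E)%E) ->
  (forall A, measurable A -> pi A = (\int[lam]_(x in A) (pid x)%:E)%E) ->
  0 < Ch -> cheeger pi Ch ->
  (forall q : R, 1 <= q -> q <= C * ln (eps^-1) ->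
     (renyi lam mud pid q <= (CR * q `^ gamma)%:E)%E /\
     (renyi lam pid mud q <= (CR * q `^ gamma)%:E)%E) ->
  atomless mu -> atomless pi ->
  forall N : nat, K * ln (eps^-1) <= N%:R ->
  forall A : set (Rd R d), measurable A ->
    (`| imh_law mu (imh_accept pid mud) N A - pi A | <= eps%:E)%E.
Proof.
(* [C = 3] admits the order [3 * L], [c] cancels the factor [3 ^ gamma] this produces, [K] is the
   constant of [imh_error_le], and [eps0] gives [L >= 4]. *)
exists 3, (3 `^ (- gamma)), (8 * expR 2), (expR (- 4)); split.
  by split; rewrite ?powR_gt0 ?mulr_gt0 ?expR_gt0.
move=> eps eps_gt0 eps_lt CR CR_gt0 CR_le d lam mu pi mud pid Ch mmud mpid mud0 pid0
  muE piE _ _ renyi_le _ _ N KN A mA.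
set L := ln eps^-1 in CR_le renyi_le KN.
have epsE : eps = expR (- L) by rewrite /L lnV ?posrE// opprK lnK.
have L4 : 4 <= L by move: eps_lt; rewrite epsE ltr_expR; lra.
pose q := 3 * L; have q1 : 1 < q by rewrite /q; lra.
(* The powers of [L] combine to [1 / L], which is below one. *)
have b1 : CR * q `^ gamma <= 1.
  have L0 : 0 < L by lra.
  apply: (@le_trans _ _ (3 `^ (- gamma) * L `^ (- (gamma + 1)) * q `^ gamma)).
    by rewrite ler_wpM2r ?powR_ge0.
  rewrite /q powRM ?(ltW L0)//.
  rewrite [X in X <= _](_ : _ = (3 `^ (- gamma) * 3 `^ gamma) * (L `^ (- (gamma + 1)) * L `^ gamma)); last by ring.
  rewrite -!powRD ?pnatr_eq0 ?(gt_eqF L0) ?implybT// addNr powRr0 mul1r.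
  rewrite opprD addrAC addNr add0r powR_inv1 ?(ltW L0)// invf_le1//; lra.
have [mupi pimu] := renyi_le q (ltW q1) (lexx _).
have pi_ac := renyi_abs_cont mpid pid0 piE mmud mud0 q1 pimu.
(* By [b1] the exponent is at most [(q - 1) * (1 - 2) = 1 - 3 * L]. *)
have tail_le : expR ((q - 1) * (CR * q `^ gamma)) / expR 2 `^ (q - 1) <= expR (1 - 3 * L).
  rewrite -expRM -expRN -expRD ler_expR /q in b1 *; nra.
have e2 : 0 < expR 2 :> R by exact: expR_gt0.
have pi_tail := renyi_tail mpid pid0 piE mmud mud0 q1 e2 pimu.
have mu_tail := renyi_tail mmud mud0 muE mpid pid0 q1 e2 mupi.
have t1 : expR (1 - 3 * L) <= 1 by rewrite -[leRHS]expR0 ler_expR; lra.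
have M1 : 1 <= expR 2 :> R by rewrite -[leLHS]expR0 ler_expR.
apply: le_trans.
  apply: (imh_law_tail_bound mpid mmud pid0 mud0 muE piE pi_ac N M1 t1 _ _ mA).
  - by apply: (le_trans pi_tail); rewrite lee_fin.
  - by apply: (le_trans mu_tail); rewrite lee_fin.
by rewrite lee_fin epsE; exact: imh_error_le.
Qed.
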